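(* Let $\mathscr{L}=L^2_{\mathbb{R}}(0,\infty)$, let $(\Omega,\mathcal{F}_\Omega,\mathbb{P})$ be the standard Wiener probability space, and let $\pi:\mathrm{CCR}(\mathscr{L})\to\mathrm{End}(\mathscr{D}_\pi)$ be the $*$-representation on $\mathscr{D}_\pi\subset L^2(\Omega,\mathbb{P})$ in which $\pi(a(k))=T_k$ is the Malliavin derivative in the direction $k$, $k\in\mathscr{L}$. Then the state on $\mathrm{CCR}(\mathscr{L})$ induced by $\pi$ and the constant function $\mathbf{1}\in L^2(\Omega,\mathbb{P})$, namely $A\mapsto\langle\mathbf{1},\pi(A)\mathbf{1}\rangle_{L^2(\Omega,\mathbb{P})}=\int_\Omega\pi(A)\mathbf{1}\,d\mathbb{P}$, is the Fock vacuum state $\omega_{Fock}$.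
   Context: On the standard Wiener space $(\Omega,\mathcal{F}_\Omega,\mathbb{P})$ (continuous paths on $[0,\infty)$, cylinder $\sigma$-algebra, Wiener measure) put $\Phi_t(\omega)=\omega(t)$ and, for $k\in\mathscr{L}=L^2_{\mathbb{R}}(0,\infty)$, $\Phi(k)=\int_0^\infty k(t)\,d\Phi_t$ (the Itô/Wiener integral). $L^2$ is the space of real-valued square-integrable functions. $\mathscr{D}_\pi\subset L^2(\Omega,\mathbb{P})$ is the dense subspace of all $F=p(\Phi(h_1),\dots,\Phi(h_n))$ with $n\in\mathbb{N}_0$, $h_i\in\mathscr{L}$, $p$ a real polynomial in $n$ variables. $T_k$ has domain $\mathscr{D}_\pi$ and $T_k(F)=\sum_{j=1}^n\frac{\partial p}{\partial x_j}(\Phi(h_1),\dots,\Phi(h_n))\langle h_j,k\rangle_{\mathscr{L}}$. $\mathrm{CCR}(\mathscr{L})$ is the unital $*$-algebra on generators $a(k)$, $a^*(k)=a(k)^*$, $k\in\mathscr{L}$ (linear in $k$), subject to $[a(k),a(l)]=0$ and $[a(k),a^*(l)]=\langle k,l\rangle_{\mathscr{L}}\mathbf{1}$. In the representation $\pi$, $\pi(a^*(k))$ is the restriction of the adjoint $T_k^*$ to $\mathscr{D}_\pi$. The Fock state $\omega_{Fock}$ on $\mathrm{CCR}(\mathscr{L})$ is the state determined by $\omega_{Fock}(a(h)a^*(k))=\langle h,k\rangle_{\mathscr{L}}$ and the vacuum property $\omega_{Fock}(a^*(h)a(h))=0$, for all $h,k\in\mathscr{L}$. *)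

(* Defs.v *)
From HB Require Import structures.
From mathcomp Require Import -(notations) mpoly.
From mathcomp Require Import all_boot all_order all_algebra.
From mathcomp Require Import generic_quotient ring_quotient.
From mathcomp Require Import all_classical all_reals all_analysis.

Set Implicit Arguments.
Unset Strict Implicit.
Unset Printing Implicit Defensive.
Import Order.TTheory GRing.Theory Num.Theory.
Import numFieldNormedType.Exports.
Local Open Scope classical_set_scope.
Local Open Scope ring_scope.

(* The unital *-algebra over [R] on generators [a k] modulo relations is built
   as the algebra of formal terms, [a^*(k)] being [TStar (TGen k)], modulo the
   smallest congruence containing the *-algebra axioms and the relations.
   Since [L] is real, so are the algebra and its involution. *)
Section CCR.
Context {R : realType} {L : lmodType R}.

Inductive ccr_term : Type :=
| TGen of L
| TZero
| TOne
| TAdd of ccr_term & ccr_term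
| TScale of R & ccr_term
| TMul of ccr_term & ccr_term
| TStar of ccr_term.

HB.instance Definition _ := gen_eqMixin ccr_term.
HB.instance Definition _ := gen_choiceMixin ccr_term.

Inductive ccr_eq (ip : L -> L -> R) : ccr_term -> ccr_term -> Prop :=
| CRefl s : ccr_eq ip s s
| CSym s t : ccr_eq ip s t -> ccr_eq ip t s
| CTrans s t u : ccr_eq ip s t -> ccr_eq ip t u -> ccr_eq ip s u
| CAdd s s' t t' : ccr_eq ip s s' -> ccr_eq ip t t' ->
    ccr_eq ip (TAdd s t) (TAdd s' t')
| CScale c t t' : ccr_eq ip t t' -> ccr_eq ip (TScale c t) (TScale c t')
| CMul s s' t t' : ccr_eq ip s s' -> ccr_eq ip t t' ->
    ccr_eq ip (TMul s t) (TMul s' t')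
| CStar t t' : ccr_eq ip t t' -> ccr_eq ip (TStar t) (TStar t')
| CAddA s t u : ccr_eq ip (TAdd s (TAdd t u)) (TAdd (TAdd s t) u)
| CAddC s t : ccr_eq ip (TAdd s t) (TAdd t s)
| CAdd0 t : ccr_eq ip (TAdd TZero t) t
| CAddN t : ccr_eq ip (TAdd (TScale (-1) t) t) TZero
| CScaleA c d t : ccr_eq ip (TScale c (TScale d t)) (TScale (c * d) t)
| CScale1 t : ccr_eq ip (TScale 1 t) t
| CScaleDr c s t :
    ccr_eq ip (TScale c (TAdd s t)) (TAdd (TScale c s) (TScale c t))
| CScaleDl c d t :
    ccr_eq ip (TScale (c + d) t) (TAdd (TScale c t) (TScale d t))
| CMulA s t u : ccr_eq ip (TMul s (TMul t u)) (TMul (TMul s t) u)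
| CMul1l t : ccr_eq ip (TMul TOne t) t
| CMul1r t : ccr_eq ip (TMul t TOne) t
| CMulDl s t u : ccr_eq ip (TMul (TAdd s t) u) (TAdd (TMul s u) (TMul t u))
| CMulDr s t u : ccr_eq ip (TMul s (TAdd t u)) (TAdd (TMul s t) (TMul s u))
| CScaleAl c s t : ccr_eq ip (TScale c (TMul s t)) (TMul (TScale c s) t)
| CScaleAr c s t : ccr_eq ip (TScale c (TMul s t)) (TMul s (TScale c t))
| CStarK t : ccr_eq ip (TStar (TStar t)) t
| CStarD s t : ccr_eq ip (TStar (TAdd s t)) (TAdd (TStar s) (TStar t))
| CStarZ c t : ccr_eq ip (TStar (TScale c t)) (TScale c (TStar t))
| CStarM s t : ccr_eq ip (TStar (TMul s t)) (TMul (TStar t) (TStar s))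
| CGenP c k l : ccr_eq ip (TGen (c *: k + l)) (TAdd (TScale c (TGen k)) (TGen l))
| CGenC k l : ccr_eq ip (TMul (TGen k) (TGen l)) (TMul (TGen l) (TGen k))
| CCCR k l : ccr_eq ip (TMul (TGen k) (TStar (TGen l)))
    (TAdd (TMul (TStar (TGen l)) (TGen k)) (TScale (ip k l) TOne)).

Variable ip : L -> L -> R.

Definition ccr_eqb (s t : ccr_term) : bool := `[< ccr_eq ip s t >].

Lemma ccr_eqb_refl : reflexive ccr_eqb.
Proof. by move=> s; apply/asboolP; exact: CRefl. Qed.

Lemma ccr_eqb_sym : symmetric ccr_eqb.
Proof. by move=> s t; apply/asboolP/asboolP; exact: CSym. Qed.

Lemma ccr_eqb_trans : transitive ccr_eqb.
Proof.
by move=> t s u /asboolP st /asboolP tu; apply/asboolP; exact: CTrans st tu.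
Qed.

Canonical ccr_equiv :=
  EquivRel ccr_eqb ccr_eqb_refl ccr_eqb_sym ccr_eqb_trans.

Local Open Scope quotient_scope.

Definition CCR : Type := {eq_quot ccr_eqb}.
HB.instance Definition _ := Choice.on CCR.
HB.instance Definition _ := EqQuotient.on CCR.

Lemma ccr_eqP (s t : ccr_term) : ccr_eq ip s t <-> \pi_CCR s = \pi_CCR t.
Proof.
split=> [st|/eqmodP/asboolP//].
by apply/eqmodP/asboolP.
Qed.

Lemma ccr_reprK (t : ccr_term) : ccr_eq ip (repr (\pi_CCR t)) t.
Proof. by apply/ccr_eqP; rewrite reprK. Qed.

Definition ccr_zero : CCR := lift_cst CCR TZero.
Definition ccr_one : CCR := lift_cst CCR TOne.
Definition ccr_add : CCR -> CCR -> CCR := lift_op2 CCR TAdd.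
Definition ccr_scale (c : R) : CCR -> CCR := lift_op1 CCR (TScale c).
Definition ccr_mul : CCR -> CCR -> CCR := lift_op2 CCR TMul.
Definition ccr_star : CCR -> CCR := lift_op1 CCR TStar.
Definition ccr_a (k : L) : CCR := lift_cst CCR (TGen k).
Definition ccr_adag (k : L) : CCR := ccr_star (ccr_a k).

Canonical pi_ccr_zero := PiConst ccr_zero.
Canonical pi_ccr_one := PiConst ccr_one.
Canonical pi_ccr_a k := PiConst (ccr_a k).

Lemma pi_ccr_add : {morph \pi_CCR : s t / TAdd s t >-> ccr_add s t}.
Proof.
by move=> s t; unlock ccr_add; apply/esym/ccr_eqP; apply: CAdd; exact: ccr_reprK.
Qed.
Canonical pi_ccr_add_morph := PiMorph2 pi_ccr_add.

Lemma pi_ccr_scale c : {morph \pi_CCR : t / TScale c t >-> ccr_scale c t}.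
Proof.
by move=> t; unlock ccr_scale; apply/esym/ccr_eqP; apply: CScale; exact: ccr_reprK.
Qed.
Canonical pi_ccr_scale_morph c := PiMorph1 (pi_ccr_scale c).

Lemma pi_ccr_mul : {morph \pi_CCR : s t / TMul s t >-> ccr_mul s t}.
Proof.
by move=> s t; unlock ccr_mul; apply/esym/ccr_eqP; apply: CMul; exact: ccr_reprK.
Qed.
Canonical pi_ccr_mul_morph := PiMorph2 pi_ccr_mul.

Lemma pi_ccr_star : {morph \pi_CCR : t / TStar t >-> ccr_star t}.
Proof.
by move=> t; unlock ccr_star; apply/esym/ccr_eqP; apply: CStar; exact: ccr_reprK.
Qed.
Canonical pi_ccr_star_morph := PiMorph1 pi_ccr_star.

Lemma ccr_addA : associative ccr_add.
Proof.
elim/quotW=> s; elim/quotW=> t; elim/quotW=> u; rewrite !piE.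
by apply/ccr_eqP; exact: CAddA.
Qed.

Lemma ccr_addC : commutative ccr_add.
Proof.
by elim/quotW=> s; elim/quotW=> t; rewrite !piE; apply/ccr_eqP; exact: CAddC.
Qed.

Lemma ccr_add0 : left_id ccr_zero ccr_add.
Proof. by elim/quotW=> t; rewrite !piE; apply/ccr_eqP; exact: CAdd0. Qed.

Lemma ccr_addN : left_inverse ccr_zero (ccr_scale (-1)) ccr_add.
Proof. by elim/quotW=> t; rewrite !piE; apply/ccr_eqP; exact: CAddN. Qed.

HB.instance Definition _ :=
  GRing.isZmodule.Build CCR ccr_addA ccr_addC ccr_add0 ccr_addN.

Lemma ccr_mulA : associative ccr_mul.
Proof.
elim/quotW=> s; elim/quotW=> t; elim/quotW=> u; rewrite !piE.
by apply/ccr_eqP; exact: CMulA.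
Qed.

Lemma ccr_mul1l : left_id ccr_one ccr_mul.
Proof. by elim/quotW=> t; rewrite !piE; apply/ccr_eqP; exact: CMul1l. Qed.

Lemma ccr_mul1r : right_id ccr_one ccr_mul.
Proof. by elim/quotW=> t; rewrite !piE; apply/ccr_eqP; exact: CMul1r. Qed.

Lemma ccr_mulDl : left_distributive ccr_mul ccr_add.
Proof.
elim/quotW=> s; elim/quotW=> t; elim/quotW=> u; rewrite !piE.
by apply/ccr_eqP; exact: CMulDl.
Qed.

Lemma ccr_mulDr : right_distributive ccr_mul ccr_add.
Proof.
elim/quotW=> s; elim/quotW=> t; elim/quotW=> u; rewrite !piE.
by apply/ccr_eqP; exact: CMulDr.
Qed.

HB.instance Definition _ := GRing.Zmodule_isPzRing.Build CCR
  ccr_mulA ccr_mul1l ccr_mul1r ccr_mulDl ccr_mulDr.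

Lemma ccr_scaleA c d (A : CCR) :
  ccr_scale c (ccr_scale d A) = ccr_scale (c * d) A.
Proof.
by elim/quotW: A => t; rewrite !piE; apply/ccr_eqP; exact: CScaleA.
Qed.

Lemma ccr_scale1 : left_id 1 ccr_scale.
Proof. by elim/quotW=> t; rewrite !piE; apply/ccr_eqP; exact: CScale1. Qed.

Lemma ccr_scaleDr : right_distributive ccr_scale +%R.
Proof.
move=> c; elim/quotW=> s; elim/quotW=> t.
by rewrite /GRing.add/= !piE; apply/ccr_eqP; exact: CScaleDr.
Qed.

Lemma ccr_scaleDl (A : CCR) :
  {morph ccr_scale^~ A : c d / c + d >-> (c + d : CCR)}.
Proof.
move=> c d; elim/quotW: A => t.
by rewrite [RHS]/GRing.add/= !piE; apply/ccr_eqP; exact: CScaleDl.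
Qed.

HB.instance Definition _ := GRing.Zmodule_isLmodule.Build R CCR
  ccr_scaleA ccr_scale1 ccr_scaleDr ccr_scaleDl.

Lemma ccr_scalerAl c (A B : CCR) : c *: (A * B) = (c *: A) * B.
Proof.
elim/quotW: A => s; elim/quotW: B => t.
by rewrite /GRing.scale/= /GRing.mul/= !piE; apply/ccr_eqP; exact: CScaleAl.
Qed.

Lemma ccr_scalerAr c (A B : CCR) : c *: (A * B) = A * (c *: B).
Proof.
elim/quotW: A => s; elim/quotW: B => t.
by rewrite /GRing.scale/= /GRing.mul/= !piE; apply/ccr_eqP; exact: CScaleAr.
Qed.

Lemma ccr_starK : involutive ccr_star.
Proof. by elim/quotW=> t; rewrite !piE; apply/ccr_eqP; exact: CStarK. Qed.

Lemma ccr_starP c (A B : CCR) :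
  ccr_star (c *: A + B) = c *: ccr_star A + ccr_star B.
Proof.
elim/quotW: A => s; elim/quotW: B => t.
rewrite /GRing.scale/= /GRing.add/= !piE; apply/ccr_eqP.
by apply: CTrans (CStarD _ _ _) _; apply: CAdd; [exact: CStarZ|exact: CRefl].
Qed.

Lemma ccr_starM (A B : CCR) : ccr_star (A * B) = ccr_star B * ccr_star A.
Proof.
elim/quotW: A => s; elim/quotW: B => t.
by rewrite /GRing.mul/= !piE; apply/ccr_eqP; exact: CStarM.
Qed.

Lemma ccr_aP c k l : ccr_a (c *: k + l) = c *: ccr_a k + ccr_a l.
Proof.
by rewrite /GRing.scale/= /GRing.add/= !piE; apply/ccr_eqP; exact: CGenP.
Qed.

Lemma ccr_aC k l : ccr_a k * ccr_a l - ccr_a l * ccr_a k = 0.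
Proof.
apply/eqP; rewrite subr_eq0; apply/eqP.
by rewrite /GRing.mul/= !piE; apply/ccr_eqP; exact: CGenC.
Qed.

Lemma ccr_a_adag k l :
  ccr_a k * ccr_adag l - ccr_adag l * ccr_a k = ip k l *: (1 : CCR).
Proof.
apply/eqP; rewrite subr_eq addrC; apply/eqP; rewrite /ccr_adag.
rewrite /GRing.add/= /GRing.scale/= /GRing.one/= /GRing.mul/= !piE.
by apply/ccr_eqP; exact: CCCR.
Qed.

(* On a real *-algebra, positivity does not imply that a functional is
   hermitian, so the latter is part of the notion of a state. *)
Record ccr_state (omega : CCR -> R) : Prop := {
  ccr_state_linear : forall c A B, omega (c *: A + B) = c * omega A + omega B;
  ccr_state_unit : omega 1 = 1;
  ccr_state_pos : forall A, 0 <= omega (ccr_star A * A);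
  ccr_state_herm : forall A, omega (ccr_star A) = omega A }.

Record fock_state (omega : CCR -> R) : Prop := {
  fock_is_state : ccr_state omega;
  fock_two_point : forall h k, omega (ccr_a h * ccr_adag k) = ip h k;
  fock_vacuum : forall h, omega (ccr_adag h * ccr_a h) = 0 }.

End CCR.

(* The library's [LspaceType] carries no vector space structure, hence the
   quotient of the vector space of square-integrable functions by the subspace
   of almost everywhere null ones. *)
Section L2.
Context d (T : measurableType d) (R : realType).
Variable mu : {measure set T -> \bar R}.

Definition sqLfun := LfunType mu (lee1n 2).

Definition ae_null : {pred sqLfun} :=
  fun f => `[< (f : T -> R) = cst 0 %[ae mu] >].

Lemma ae_nullP (f : sqLfun) :
  reflect ((f : T -> R) = cst 0 %[ae mu]) (f \in ae_null).
Proof. exact: asboolP. Qed.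

Lemma ae_null_submod : submod_closed ae_null.
Proof.
split=> [|c f g /ae_nullP f0 /ae_nullP g0]; apply/ae_nullP.
  exact: ae_eq_refl.
apply: filterS2 f0 g0 => x /= f0 g0 xT.
change (c * f x + g x = 0).
by rewrite (f0 xT) (g0 xT) mulr0 addr0.
Qed.

HB.instance Definition _ := GRing.isSubmodClosed.Build R sqLfun ae_null
  ae_null_submod.

Definition L2 : Type := Quotient.quot ae_null.
HB.instance Definition _ := ZmodQuotient.on L2.
HB.instance Definition _ := GRing.Zmodule.on L2.

Local Open Scope quotient_scope.

Definition L2_class (f : sqLfun) : L2 := \pi_L2 f.
Definition L2_fun (f : L2) : T -> R := (repr f : sqLfun).

Lemma L2_classP (f g : sqLfun) :
  L2_class f = L2_class g <-> (f : T -> R) = g %[ae mu].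
Proof.
rewrite /L2_class; split=> [/eqP|fg].
  rewrite -Quotient.idealrBE => /ae_nullP.
  apply: filterS => x /= + xT => /(_ xT) /=.
  by rewrite /cst => /subr0_eq.
apply/eqP; rewrite -Quotient.idealrBE; apply/ae_nullP.
apply: filterS fg => x /= fg xT; change (f x - g x = 0).
by rewrite (fg xT) subrr.
Qed.

Lemma L2_funK (f : L2) : L2_class (repr f) = f.
Proof. exact: reprK. Qed.

Lemma L2_fun_class (f : sqLfun) : L2_fun (L2_class f) = f %[ae mu].
Proof. by apply/L2_classP; rewrite L2_funK. Qed.

Definition L2_scale (c : R) (f : L2) : L2 := L2_class (c *: (repr f : sqLfun)).

Lemma L2_classZ c f : L2_class (c *: f) = L2_scale c (L2_class f).
Proof.
apply/L2_classP; have := L2_fun_class f; apply: filterS => x /= fE xT.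
change (c * f x = c * L2_fun (L2_class f) x).
by rewrite (fE xT).
Qed.

Lemma L2_classD f g : L2_class (f + g) = L2_class f + L2_class g.
Proof. by rewrite /L2_class !piE. Qed.

Lemma L2_scaleA c d' f : L2_scale c (L2_scale d' f) = L2_scale (c * d') f.
Proof. by rewrite -(L2_funK f) -!L2_classZ scalerA. Qed.

Lemma L2_scale1 : left_id 1 L2_scale.
Proof. by move=> f; rewrite -(L2_funK f) -L2_classZ scale1r. Qed.

Lemma L2_scaleDr : right_distributive L2_scale +%R.
Proof.
move=> c f g; rewrite -(L2_funK f) -(L2_funK g).
by rewrite -L2_classD -!L2_classZ -L2_classD scalerDr.
Qed.

Lemma L2_scaleDl f : {morph L2_scale^~ f : c d / c + d}.
Proof.
by move=> c d'; rewrite -(L2_funK f) -!L2_classZ -L2_classD scalerDl.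
Qed.

HB.instance Definition _ := GRing.Zmodule_isLmodule.Build R L2
  L2_scaleA L2_scale1 L2_scaleDr L2_scaleDl.

Definition L2_ip (f g : L2) : R := Rintegral mu setT (L2_fun f \* L2_fun g).

Lemma L2_funP c (f g : L2) :
  L2_fun (c *: f + g) = (fun x => c * L2_fun f x + L2_fun g x) %[ae mu].
Proof.
have E : c *: f + g = L2_class (c *: repr f + repr g).
  by rewrite L2_classD L2_classZ !L2_funK.
apply: filterS (L2_fun_class (c *: repr f + repr g)) => x + xT => /(_ xT).
by rewrite -E.
Qed.

End L2.

Coercion L2_fun : L2 >-> Funclass.

Section Wiener.
Variable R : realType.

Definition halfline : set R := [set t | 0 <= t].

Definition time0 : halfline := exist _ 0 (mem_set (lexx 0 : halfline 0)).

(* [halfline] is seen as a type, with the subspace topology. *)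
Definition wiener_path : Type := {w : halfline -> R | continuous w}.
HB.instance Definition _ := gen_eqMixin wiener_path.
HB.instance Definition _ := gen_choiceMixin wiener_path.

Definition path_fun (w : wiener_path) : halfline -> R := proj1_sig w.
Coercion path_fun : wiener_path >-> Funclass.

Lemma cst0_continuous : continuous (cst 0 : halfline -> R).
Proof. exact: cst_continuous. Qed.

HB.instance Definition _ := isPointed.Build wiener_path
  (exist _ _ cst0_continuous : wiener_path).

Definition cylinders : set (set wiener_path) :=
  [set C | exists t : halfline, exists2 B : set R,
     measurable B & C = [set w : wiener_path | B (w t)]].

Definition wiener_space := g_sigma_algebraType cylinders.

Definition increment_in (s t : halfline) (B : set R) : set wiener_space :=
  [set w : wiener_path | B (w t - w s)].

Record is_wiener_measure (P : probability wiener_space R) : Prop := {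
  wiener_start : P [set w : wiener_path | w time0 = 0] = 1%E;
  wiener_gaussian : forall (s t : halfline) (B : set R),
    \val s < \val t -> measurable B ->
    P (increment_in s t B) =
    normal_prob 0 (Num.sqrt (\val t - \val s)) B;
  wiener_independent : forall (n : nat) (t : nat -> halfline) (B : nat -> set R),
    {homo t : i j / (i <= j)%N >-> \val i <= \val j} ->
    (forall i, measurable (B i)) ->
    P (\bigcap_(i in `I_n) increment_in (t i) (t i.+1) (B i)) =
    (\prod_(i < n) P (increment_in (t i) (t i.+1) (B i)))%E }.

Definition lebesgue_pos : {measure set (measurableTypeR R) -> \bar R} :=
  mrestr lebesgue_measure (measurable_itv (`]0, +oo[ : interval R)).

Notation L2pos := (L2 lebesgue_pos).

(* [(c, (s, t)) :: _] stands for [c 1_{]s, t]} + ...] *)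
Definition step := seq (R * (halfline * halfline)).

Definition step_wf (f : step) : bool :=
  all (fun e : R * (halfline * halfline) => \val e.2.1 <= \val e.2.2) f.

Definition step_fun (f : step) (x : R) : R :=
  \sum_(e <- f) e.1 * \1_(`]\val e.2.1, \val e.2.2]) x.

Definition step_integral (f : step) (w : wiener_path) : R :=
  \sum_(e <- f) e.1 * (w e.2.2 - w e.2.1).

Variable P : probability wiener_space R.

Definition is_wiener_integral (k : L2pos) (X : L2 P) : Prop :=
  exists f : nat -> step,
  [/\ forall n, step_wf (f n),
      (\int[lebesgue_pos]_x ((step_fun (f n) x - k x) ^+ 2)%:E)%E
        @[n --> \oo] --> 0%E &
      (\int[P]_w ((step_integral (f n) w - X w) ^+ 2)%:E)%E
        @[n --> \oo] --> 0%E].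

(* Every [k] has exactly one such limit in [L^2(P)] when [P] is the Wiener
   measure; the default value 0 is then not used. *)
Definition wiener_integral (k : L2pos) : L2 P :=
  xget 0 [set X | is_wiener_integral k X].

Definition cylinder_fun n (p : mpoly n R) (h : 'I_n -> L2pos)
    (w : wiener_space) : R :=
  meval (fun i => wiener_integral (h i) w) p.

Definition Dpi_pred : {pred L2 P} := fun F =>
  `[< exists n (p : mpoly n R) (h : 'I_n -> L2pos),
        (F : _ -> R) = cylinder_fun p h %[ae P] >].

Lemma DpiP (F : L2 P) : reflect (exists n (p : mpoly n R) (h : 'I_n -> L2pos),
  (F : _ -> R) = cylinder_fun p h %[ae P]) (F \in Dpi_pred).
Proof. exact: asboolP. Qed.

Lemma cylinder_funP c n (p : mpoly n R) (h : 'I_n -> L2pos)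
    m (q : mpoly m R) (g : 'I_m -> L2pos) :
  exists (r : mpoly (n + m) R) (u : 'I_(n + m) -> L2pos),
  forall w, cylinder_fun r u w = c * cylinder_fun p h w + cylinder_fun q g w.
Proof.
pose u (i : 'I_(n + m)) := match fintype.split i with inl j => h j | inr j => g j end.
pose Xl := [tuple mpolyX R (mnm1 (lshift m i)) | i < n].
pose Xr := [tuple mpolyX R (mnm1 (rshift n i)) | i < m].
exists (c *: comp_mpoly Xl p + comp_mpoly Xr q), u => w.
rewrite /cylinder_fun mevalD mevalZ !comp_mpoly_meval.
by congr (_ * _ + _); apply: meval_eq => i;
  rewrite tnth_mktuple mevalXU /u -/(unsplit (inl i)) -/(unsplit (inr i))
    unsplitK.
Qed.

Lemma Dpi_submod : submod_closed Dpi_pred.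
Proof.
split=> [|c F G /DpiP[n [p [h Fp]]] /DpiP[m [q [g Gq]]]].
  apply/DpiP; exists 0%N, 0, (fun=> 0).
  apply: filterS (L2_fun_class (0 : sqLfun P)) => w + wT => /(_ wT).
  rewrite /cylinder_fun meval0 [L2_class 0](_ : _ = 0); first exact.
  by rewrite /L2_class !piE.
have [r [u ru]] := cylinder_funP c p h q g.
apply/DpiP; exists (n + m)%N, r, u.
apply: filterS (filterI (L2_funP c F G) (filterI Fp Gq)) => w [E [Fw Gw]] wT.
by rewrite ru (E wT) (Fw wT) (Gw wT).
Qed.

HB.instance Definition _ := GRing.isSubmodClosed.Build R (L2 P) Dpi_pred
  Dpi_submod.

Record Dpi : Type := MkDpi { Dpi_val :> L2 P ; _ : Dpi_val \in Dpi_pred }.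
HB.instance Definition _ := [isSub for Dpi_val].
HB.instance Definition _ := [Choice of Dpi by <:].
HB.instance Definition _ := [SubChoice_isSubLmodule of Dpi by <:].

Lemma cst1_Lfun : cst 1 \in Lfun P 2%:R%:E.
Proof. exact: Lfun_cst. Qed.

Definition L2_one : L2 P := L2_class (Lfun_Sub (lee1n 2) cst1_Lfun).

Lemma L2_oneE : (L2_one : _ -> R) = cst 1 %[ae P].
Proof. exact: L2_fun_class. Qed.

Lemma L2_one_Dpi : L2_one \in Dpi_pred.
Proof.
apply/DpiP; exists 0%N, 1, (fun=> 0).
apply: filterS L2_oneE => w + wT => /(_ wT) ->.
by rewrite /cylinder_fun meval1.
Qed.

Definition Dpi_one : Dpi := MkDpi L2_one_Dpi.

(* [T = T_k]: the formula is required of every presentation of [F] as a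
   polynomial in Wiener integrals, since [T_k] does not depend on it. *)
Definition is_malliavin_derivative (k : L2pos) (T : Dpi -> Dpi) : Prop :=
  forall n (p : mpoly n R) (h : 'I_n -> L2pos) (F : Dpi),
    (F : _ -> R) = cylinder_fun p h %[ae P] ->
    (T F : _ -> R) =
      (fun w => \sum_(j < n) cylinder_fun (mderiv j p) h w
                             * L2_ip (h j) k) %[ae P].

Definition CCRpos := CCR (@L2_ip _ _ _ lebesgue_pos).

Record is_star_representation (pi : CCRpos -> {linear Dpi -> Dpi}) : Prop := {
  rep_linear : forall c A B F, pi (c *: A + B) F = c *: pi A F + pi B F;
  rep_unit : forall F, pi 1 F = F;
  rep_mul : forall A B F, pi (A * B) F = pi A (pi B F);
  rep_star : forall A (F G : Dpi), L2_ip (pi A F) G = L2_ip F (pi (ccr_star A) G) }.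

Definition vacuum_functional (pi : CCRpos -> {linear Dpi -> Dpi}) (A : CCRpos) : R :=
  L2_ip Dpi_one (pi A Dpi_one).

End Wiener.

(* Main.v *)
(** By the CCR a Fock state [f] is determined on words in the [a k] and [a* k].
   The vacuum property and positivity give [f (B * a k) = 0] for all [B]
   (Cauchy-Schwarz); moving the annihilators of a word to the right one letter
   at a time leaves commutator terms, which are shorter words. For the
   vector state of [1], all the requirements follow from [T_k 1 = 0] and the
   *-representation property. *)
Require Import Defs.
From mathcomp Require Import -(notations) mpoly.
From mathcomp Require Import all_boot all_order all_algebra.
From mathcomp Require Import all_classical all_reals all_analysis.
From mathcomp Require Import measurable_realfun.
From mathcomp Require Import zify ring lra.
Set Implicit Arguments.
Unset Strict Implicit.
Unset Printing Implicit Defensive.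
Import Order.TTheory GRing.Theory Num.Theory.
Import numFieldNormedType.Exports.
Local Open Scope classical_set_scope.
Local Open Scope ring_scope.

(** * Words in the CCR algebra and uniqueness of the Fock state *)

Section FockState.
Context {R : realType} {L : lmodType R} (ip : L -> L -> R).

Lemma ccr_starD (A B : CCR ip) : ccr_star (A + B) = ccr_star A + ccr_star B.
Proof. by have := ccr_starP 1 A B; rewrite !scale1r. Qed.

Lemma ccr_star0 : ccr_star (0 : CCR ip) = 0.
Proof. by apply: (@addrI _ (ccr_star 0)); rewrite -ccr_starD !addr0. Qed.

Lemma ccr_star1 : ccr_star (1 : CCR ip) = 1.
(* Rewriting the right factor of [ccr_star 1 * 1] as [ccr_star (ccr_star 1)] turns the product into
   the star of [ccr_star 1 * 1]. *)
Proof. by rewrite -[LHS]mulr1 -{2}(ccr_starK 1) -ccr_starM mulr1 ccr_starK. Qed.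

Lemma ccr_a_mul_adag h k :
  ccr_a ip h * ccr_adag ip k =
  ip h k *: (1 : CCR ip) + ccr_adag ip k * ccr_a ip h.
Proof. by rewrite -ccr_a_adag subrK. Qed.

Definition ccr_letter (x : bool * L) : CCR ip :=
  if x.1 then ccr_adag ip x.2 else ccr_a ip x.2.

Definition ccr_word (s : seq (bool * L)) : CCR ip :=
  \prod_(x <- s) ccr_letter x.

Lemma ccr_word0 : ccr_word [::] = 1.
Proof. exact: big_nil. Qed.

Lemma ccr_word_cat s t : ccr_word (s ++ t) = ccr_word s * ccr_word t.
Proof. exact: big_cat. Qed.

Lemma ccr_word_cons x t : ccr_word (x :: t) = ccr_letter x * ccr_word t.
Proof. exact: big_cons. Qed.

Lemma ccr_word1 x : ccr_word [:: x] = ccr_letter x.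
Proof. exact: big_seq1. Qed.

(** The star reverses the word and flips the flag of each letter. *)
Lemma ccr_star_word s : exists t, ccr_star (ccr_word s) = ccr_word t.
Proof.
elim: s => [|[b k] s [t IH]].
  by exists [::]; rewrite ccr_word0 ccr_star1.
exists (t ++ [:: (~~ b, k)]).
rewrite ccr_word_cat ccr_word1 ccr_word_cons ccr_starM IH.
by case: b; rewrite /ccr_letter //= /ccr_adag ccr_starK.
Qed.

(** Combinations grow by one word at a time, so that induction matches the form [c *: A + B] of
    linearity in [ccr_state]. *)
Inductive ccr_span : CCR ip -> Prop :=
| CSpan0 : ccr_span 0
| CSpanP c s A : ccr_span A -> ccr_span (c *: ccr_word s + A).

Lemma ccr_span_word s : ccr_span (ccr_word s).
Proof.
by rewrite -[ccr_word s]scale1r -[_ *: _]addr0; do 2!constructor.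
Qed.

Lemma ccr_spanP c (A B : CCR ip) :
  ccr_span A -> ccr_span B -> ccr_span (c *: A + B).
Proof.
move=> spA spB; elim: spA => [|d s A' _ IH]; first by rewrite scaler0 add0r.
by rewrite scalerDr scalerA -addrA; constructor.
Qed.

Lemma ccr_spanM (A B : CCR ip) : ccr_span A -> ccr_span B -> ccr_span (A * B).
Proof.
move=> spA spB; elim: spA => [|c s A' _ IH].
  by rewrite mul0r; constructor.
rewrite mulrDl -ccr_scalerAl; apply: ccr_spanP => //.
elim: spB => [|d t B' _ IHB]; first by rewrite mulr0; constructor.
by rewrite mulrDr -ccr_scalerAr -ccr_word_cat; constructor.
Qed.

Lemma ccr_span_star (A : CCR ip) : ccr_span A -> ccr_span (ccr_star A).
Proof.
elim=> [|c s A' _ IH]; first by rewrite ccr_star0; constructor.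
have [t st] := ccr_star_word s.
by rewrite ccr_starP st; constructor.
Qed.

(** Induction on a term representing [A]: the span contains the generators and is closed under every
    operation. *)
Lemma ccr_span_all (A : CCR ip) : ccr_span A.
Proof.
elim/quotW: A; elim=> [k|||s IHs t IHt|c t IH|s IHs t IHt|t IH].
- by have := ccr_span_word [:: (false, k)]; rewrite ccr_word1 /ccr_letter/= piE.
- by have := CSpan0; rewrite /GRing.zero/= piE.
- by have := ccr_span_word [::]; rewrite ccr_word0 /GRing.one/= piE.
- by have := ccr_spanP 1 IHs IHt; rewrite scale1r pi_ccr_add.
- by have := ccr_spanP c IH CSpan0; rewrite addr0 pi_ccr_scale.
- by have := ccr_spanM IHs IHt; rewrite pi_ccr_mul.
- by have := ccr_span_star IH; rewrite pi_ccr_star.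
Qed.

Lemma ccr_state0 (f : CCR ip -> R) : ccr_state f -> f 0 = 0.
Proof.
by move=> sf; have := ccr_state_linear sf (-1) 0 0; rewrite scaler0 addr0; lra.
Qed.

(** Positivity is applied to [c *: ccr_a ip h + ccr_star B]. The coefficient of [c ^+ 2] vanishes by
    the vacuum property, and an affine function of [c] that stays nonnegative has slope zero. *)
Lemma fock_state_mulr_a (f : CCR ip -> R) (B : CCR ip) (h : L) :
  fock_state f -> f (B * ccr_a ip h) = 0.
Proof.
move=> [sf _ vac].
have lin := ccr_state_linear sf.
have D (X Y : CCR ip) : f (X + Y) = f X + f Y.
  by have := lin 1 X Y; rewrite scale1r mul1r.
have Z c (X : CCR ip) : f (c *: X) = c * f X.
  by have := lin c X 0; rewrite !addr0 (ccr_state0 sf) addr0.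
have pos c : 0 <= 2 * c * f (B * ccr_a ip h) + f (B * ccr_star B).
  have := ccr_state_pos sf (c *: ccr_a ip h + ccr_star B).
  rewrite ccr_starP ccr_starK mulrDl !mulrDr.
  rewrite -!ccr_scalerAl -!ccr_scalerAr scalerA !D !Z vac.
  (* The two cross terms are adjoint to each other, so they agree because [f] is hermitian. *)
  have <- : f (B * ccr_a ip h) = f (ccr_star (ccr_a ip h) * ccr_star B).
    by rewrite -ccr_starM (ccr_state_herm sf).
  lra.
set x := f _ in pos *; set y := f _ in pos.
(* For [x != 0] this value of [c] makes the affine function equal to -1. *)
apply/eqP/negPn/negP => x0; have := pos (- (y + 1) / (2 * x)).
have -> : 2 * (- (y + 1) / (2 * x)) * x = - (y + 1) by field.
lra.
Qed.

Lemma fock_state_mull_adag (f : CCR ip -> R) (B : CCR ip) (h : L) :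
  fock_state f -> f (ccr_adag ip h * B) = 0.
Proof.
move=> ff; rewrite -(ccr_state_herm (fock_is_state ff)) ccr_starM.
by rewrite /ccr_adag ccr_starK fock_state_mulr_a.
Qed.

(** Strong induction on the length. A leading creator gives 0; a leading annihilator is moved to the
    right end, where it gives 0 as well. *)
Lemma fock_state_word (f g : CCR ip -> R) (s : seq (bool * L)) :
  fock_state f -> fock_state g -> f (ccr_word s) = g (ccr_word s).
Proof.
move=> ff fg; have [n] := ubnP (size s); elim: n s => // n IH [|[[] h] t] szt.
- by rewrite ccr_word0 !(ccr_state_unit (fock_is_state _)).
- by rewrite ccr_word_cons !fock_state_mull_adag.
(* Generalized over the prefix [u] that the annihilator has already crossed. *)
suff H u : (size u + size t < n)%N ->
    f (ccr_word u * (ccr_a ip h * ccr_word t)) =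
    g (ccr_word u * (ccr_a ip h * ccr_word t)).
  by have := H [::] szt; rewrite ccr_word0 !mul1r ccr_word_cons.
elim: t u {szt} => [|[b k] t IHt] u sz.
  by rewrite ccr_word0 mulr1 !fock_state_mulr_a.
have {IHt} := IHt (u ++ [:: (b, k)]).
rewrite size_cat /= addn1 addSnnS => /(_ sz).
rewrite ccr_word_cat ccr_word1 ccr_word_cons /ccr_letter /=; case: b sz => /= sz E.
  (* Crossing a creator leaves a multiple of the word [u ++ t], two letters shorter, to which the
     outer induction applies. *)
  rewrite [ccr_a _ _ * _]mulrA ccr_a_mul_adag mulrDl mulrDr.
  rewrite -ccr_scalerAl mul1r -ccr_scalerAr !(ccr_state_linear (fock_is_state _))//.
  rewrite -ccr_word_cat IH; last by rewrite size_cat; lia.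
  by rewrite -!mulrA in E *; rewrite E.
have comm : ccr_a ip h * ccr_a ip k = ccr_a ip k * ccr_a ip h.
  by apply/eqP; rewrite -subr_eq0 ccr_aC.
by rewrite [ccr_a _ h * (_ * _)]mulrA comm -!mulrA in E *.
Qed.

Lemma fock_state_unique (f g : CCR ip -> R) :
  fock_state f -> fock_state g -> f = g.
Proof.
move=> ff fg; apply/funext => A; elim: (ccr_span_all A) => [|c s B _ IH].
  by rewrite !ccr_state0//; exact: fock_is_state.
by rewrite !(ccr_state_linear (fock_is_state _))// IH (fock_state_word _ ff fg).
Qed.

End FockState.

(** * Bilinearity and symmetry of the inner product on classes of functions *)

Section L2.
Context d (T : measurableType d) (R : realType).
Variable mu : {measure set T -> \bar R}.

Lemma L2_eqP (f g : L2 mu) : (f : T -> R) = g %[ae mu] -> f = g.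
Proof. by move=> fg; rewrite -(L2_funK f) -(L2_funK g); apply/L2_classP. Qed.

Lemma L2_mul_integrable (f g : L2 mu) :
  mu.-integrable setT (EFin \o (L2_fun f \* L2_fun g)).
Proof. by apply/Lfun1_integrable/Lfun2_mul_Lfun1; exact: LfunP. Qed.

Lemma L2_fun_measurable (f : L2 mu) : measurable_fun setT (f : T -> R).
Proof.
by have := LfunP (repr f : sqLfun mu); rewrite inE => /andP[+ _]; rewrite inE.
Qed.

Lemma ae_eq_Rintegral (f g : T -> R) :
  measurable_fun setT f -> measurable_fun setT g -> f = g %[ae mu] ->
  \int[mu]_x f x = \int[mu]_x g x.
Proof.
move=> mf mg fg; congr fine; apply: ae_eq_integral => //.
- exact/measurable_EFinP.
- exact/measurable_EFinP.
- by apply: filterS fg => x /= fgx xT; rewrite fgx.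
Qed.

Lemma L2_ipC (f g : L2 mu) : L2_ip f g = L2_ip g f.
Proof. by apply: eq_Rintegral => x _ /=; rewrite mulrC. Qed.

(** Representatives of classes are chosen, so [L2_fun] is linear only almost everywhere, which
    suffices under the integral. *)
Lemma L2_ipPr c (f g h : L2 mu) :
  L2_ip f (c *: g + h) = c * L2_ip f g + L2_ip f h.
Proof.
rewrite /L2_ip -RintegralZl//; last exact: L2_mul_integrable.
rewrite -RintegralD//; first last.
- exact: L2_mul_integrable.
- have := integrableZl measurableT c (L2_mul_integrable f g).
  by apply: eq_integrable.
have m := @L2_fun_measurable.
apply: ae_eq_Rintegral.
- exact: measurable_funM.
- by apply: measurable_funD; [apply: measurable_funM => //|]; exact: measurable_funM.
- by apply: filterS (L2_funP c g h) => x E xT /=; rewrite (E xT); ring.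
Qed.

Lemma L2_ip_ge0 (f : L2 mu) : 0 <= L2_ip f f.
Proof. by apply: Rintegral_ge0 => x _ /=; rewrite -expr2 sqr_ge0. Qed.

End L2.

Lemma L2_ip1f (R : realType) (P : probability (wiener_space R) R) (F : L2 P) :
  L2_ip (L2_one P) F = \int[P]_w F w.
Proof.
have m := @L2_fun_measurable _ _ R P.
apply: ae_eq_Rintegral => //; first exact: measurable_funM.
by apply: filterS (L2_oneE P) => w E wT /=; rewrite (E wT) mul1r.
Qed.

(** * The vector state of the constant function *)

(** Presented by a polynomial in no variables, the constant 1 has an empty sum as its derivative. *)
Lemma malliavin_derivative_one (R : realType)
    (P : probability (wiener_space R) R) k (T : Dpi P -> Dpi P) :
  is_malliavin_derivative k T -> T (Dpi_one P) = 0.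
Proof.
move=> mT; have /mT : (Dpi_one P : _ -> R) =
    @cylinder_fun R P 0 1 (fun=> 0) %[ae P].
  apply: filterS (L2_oneE P) => w + wT => /(_ wT) ->.
  by rewrite /cylinder_fun meval1.
move=> T0; apply/val_inj/L2_eqP.
(* The chosen representative of the class 0 vanishes only almost everywhere; this follows from
   [0 = -1 *: 0 + 0]. *)
have E := L2_funP (-1) (0 : L2 P) 0.
rewrite scaler0 addr0 in E.
apply: filterS (filterI T0 E) => w [{}T0 {}E] wT; rewrite (T0 wT) big_ord0.
by have := E wT; rewrite mulN1r addNr.
Qed.

Lemma vacuum_fock_state (R : realType) (P : probability (wiener_space R) R)
    (pi : CCRpos R -> {linear Dpi P -> Dpi P}) :
  is_star_representation pi ->
  (forall k, is_malliavin_derivative k (pi (ccr_a _ k))) ->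
  fock_state (vacuum_functional pi).
Proof.
move=> rpi mpi.
have a1 k : pi (ccr_a _ k) (Dpi_one P) = 0 := malliavin_derivative_one (mpi k).
have lin c A B : vacuum_functional pi (c *: A + B) =
    c * vacuum_functional pi A + vacuum_functional pi B.
  by rewrite /vacuum_functional (rep_linear rpi) -L2_ipPr.
have unit : vacuum_functional pi 1 = 1.
  rewrite /vacuum_functional (rep_unit rpi) L2_ip1f.
  rewrite (ae_eq_Rintegral _ _ (L2_oneE P))// Rintegral_cst// mul1r.
  exact: (congr1 fine (probability_setT P)).
(* An arbitrary left factor serves both the vacuum property and the two-point function, where the
   CCR leaves a term ending in an annihilator. *)
have vac A h : vacuum_functional pi (A * ccr_a _ h) = 0.
  rewrite /vacuum_functional (rep_mul rpi) a1 linear0.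
  have := L2_ipPr (-1) (Dpi_one P) 0 0; rewrite scaler0 addr0.
  by rewrite mulN1r addNr.
split=> // [|h k].
- split=> // A.
  (* Moving [ccr_star A] across the inner product gives the squared norm of [pi A (Dpi_one P)]. *)
  + by rewrite /vacuum_functional (rep_mul rpi) -(rep_star rpi) L2_ip_ge0.
  + by rewrite /vacuum_functional -(rep_star rpi) L2_ipC.
by rewrite ccr_a_mul_adag lin vac unit mulr1 addr0.
Qed.

Theorem corollary4p3 (R : realType) (P : probability (wiener_space R) R)
    (pi : CCRpos R -> {linear Dpi P -> Dpi P}) :
  is_wiener_measure P ->
  is_star_representation pi ->
  (forall k : L2 (lebesgue_pos R), is_malliavin_derivative k (pi (ccr_a _ k))) ->
  (forall A : CCRpos R, vacuum_functional pi A =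
     (\int[P]_w (pi A (Dpi_one P) : L2 P) w)%R) /\
  unique (fock_state (ip := @L2_ip _ _ _ (lebesgue_pos R))) (vacuum_functional pi).
Proof.
move=> _ rpi mpi; split=> [A|]; first exact: L2_ip1f.
have fock := vacuum_fock_state rpi mpi.
by split=> // f; exact: fock_state_unique.
Qed.
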